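(* Let $X$ be a Banach space and let $x\in S_X$. (1) If $X$ has the Radon--Nikodým property, then $x$ is an AD point if and only if for every $y\in\mathrm{dent}(B_X)$ there exists $\theta\in\mathbb{T}$ such that $\|x+\theta y\|=2$. (2) If $X$ has the convex point of continuity property, then $x$ is a super AD point if and only if for every $z\in\mathrm{PC}(B_X)\cap S_X$ there exists $\theta\in\mathbb{T}$ such that $\|x+\theta z\|=2$.
   Context: Banach spaces are over $\mathbb{K}$ ($\mathbb{R}$ or $\mathbb{C}$); $B_X$, $S_X$ denote the closed unit ball and the unit sphere of $X$; $\mathbb{T}=\{\theta\in\mathbb{K}:|\theta|=1\}$. A slice of a bounded set $A$ is a set $\{y\in A:\mathrm{Re}\,x^*(y)>\sup\mathrm{Re}\,x^*(A)-\alpha\}$ with $x^*\in X^*\setminus\{0\}$, $\alpha>0$. A point $x\in S_X$ is an AD point if $\sup_{y\in S}\max_{\theta\in\mathbb{T}}\|x+\theta y\|=2$ for every slice $S$ of $B_X$; it is a super AD point if $\sup_{y\in W}\max_{\theta\in\mathbb{T}}\|x+\theta y\|=2$ for every non-empty relatively weakly open subset $W$ of $B_X$ with $W\cap S_X\neq\emptyset$. $\mathrm{dent}(A)$ is the set of denting points of $A$ (points of $A$ contained in slices of $A$ of arbitrarily small diameter). $\mathrm{PC}(A)$ is the set of points of continuity of $A$ (points of $A$ at which the identity $(A,\text{weak})\to(A,\|\cdot\|)$ is continuous). $X$ has the Radon--Nikodým property if every non-empty closed convex bounded subset of $X$ has a denting point, and the convex point of continuity property if every non-empty closed convex bounded subset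 of $X$ has a point of continuity. *)

(* Defs.v *)
From HB Require Import structures.
From mathcomp Require Import all_boot all_order all_algebra.
From mathcomp Require Import all_classical all_reals all_analysis.
From mathcomp.real_closed Require Import complex.

Set Implicit Arguments.
Unset Strict Implicit.
Unset Printing Implicit Defensive.

Import Order.TTheory GRing.Theory Num.Theory.
Import numFieldNormedType.Exports.

Local Open Scope classical_set_scope.
Local Open Scope ring_scope.

Variant scalar_kind := RealScalars | ComplexScalars.

Definition scalar_field (R : realType) (k : scalar_kind) : numFieldType :=
  match k with
  | RealScalars => R
  | ComplexScalars => complex R
  end.

Definition re (R : realType) (k : scalar_kind) : scalar_field R k -> R :=
  match k with
  | RealScalars => fun a : R => a
  | ComplexScalars => @complex.Re R
  end.

Section Banach.
Variables (R : realType) (k : scalar_kind).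
Local Notation K := (scalar_field R k).

Definition unit_scalars : set K := [set theta | `|theta| = 1].

Variable X : completeNormedModType K.
Implicit Types (x y : X) (A S W : set X).

(* The norm of [X] is [K]-valued; this is the same number as an element of
   [R], where suprema are available. *)
Definition rnorm x : R := re `|x|.

Definition unit_ball : set X := [set x | `|x| <= 1].

Definition unit_sphere : set X := [set x | `|x| = 1].

Definition dual : set {linear X -> K^o} := [set f | continuous f].

Definition weak : topologicalType :=
  initial_topology
    ((fun x (f : dual) => set_val f x) :
       X -> prod_topology (fun _ : dual => (K^o : topologicalType))).

Definition slice A S := exists (f : {linear X -> K^o}) (alpha : R),
  [/\ dual f, (f : X -> K^o) <> (fun=> 0), 0 < alpha &
      S = [set y | A y /\ sup [set re (f z) | z in A] - alpha < re (f y)]].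

Definition relatively_weakly_open A W :=
  exists2 U : set weak, open U & W = A `&` U.

Definition diam A : \bar R :=
  ereal_sup [set (rnorm (y - z))%:E | y in A & z in A].

Definition denting_points A : set X := [set x | A x /\
  forall e : R, 0 < e -> exists S, [/\ slice A S, S x & (diam S < e%:E)%E]].

Definition points_of_continuity A : set X := [set x | A x /\
  (fun y : weak => (y : X)) @ within A (nbhs (x : weak)) --> x].

(* This supremum is a maximum, [unit_scalars] being compact. *)
Definition max_rotation x y : R :=
  sup [set rnorm (x + theta *: y) | theta in unit_scalars].

Definition AD_point x := unit_sphere x /\
  forall S, slice unit_ball S -> sup [set max_rotation x y | y in S] = 2.

Definition super_AD_point x := unit_sphere x /\
  forall W, relatively_weakly_open unit_ball W -> W !=set0 ->
    W `&` unit_sphere !=set0 -> sup [set max_rotation x y | y in W] = 2.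

(* [convex_set] uses coefficients [0 <= t <= 1] in [K]: for complex scalars,
   such a [t] is real, so that this is the usual convexity. *)
Definition Radon_Nikodym_property := forall A, A !=set0 -> closed A ->
  @convex_set K X A -> bounded_set A -> denting_points A !=set0.

Definition convex_point_of_continuity_property := forall A, A !=set0 ->
  closed A -> @convex_set K X A -> bounded_set A ->
  points_of_continuity A !=set0.

End Banach.

Arguments dual {R k} X.
Arguments weak {R k} X.
Arguments unit_scalars {R k}.
Arguments unit_ball {R k X}.
Arguments unit_sphere {R k X}.

(* Main.v *)
From HB Require Import structures.
Require Import Defs.
From mathcomp Require Import all_boot all_order all_algebra.
From mathcomp Require Import all_classical all_reals all_analysis.
From mathcomp Require Import complex ring lra.

(* A functional is handled through its real part, a real-linear function bounded
   by a multiple of the norm.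

   If [y] is denting (or a point of continuity of norm 1), then some points [z]
   arbitrarily close to [y] have a rotation [theta z] with [|x + theta z|]
   almost 2, and compactness of the unit scalars yields the exact equality.
   Conversely it suffices to find a denting point in every slice of the ball,
   respectively a point of continuity of norm 1 in every weakly open set [W]
   that meets the sphere. By Cantor's intersection theorem, this reduces to
   finding smaller slices (weakly open sets) of arbitrarily small diameter in a
   given one.

   Slices: a denting point of the closed convex hull of the points of the ball
   that are supported by functionals close to the given one provides a
   perturbation of this functional whose slices are small; this uses the
   Bishop-Phelps technique (Ekeland's principle and the Hahn-Banach theorem).

   Weakly open sets: a point of continuity of a weakly closed convex piece is
   moved inside this piece. A point of continuity of norm less than 1 exists
   only if the weak and norm topologies agree, and then any point of [W] on the
   sphere is a point of continuity. *)

Import Order.TTheory GRing.Theory Num.Theory.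
Import numFieldNormedType.Exports.

Local Open Scope classical_set_scope.
Local Open Scope ring_scope.

Set Implicit Arguments.
Unset Strict Implicit.
Unset Printing Implicit Defensive.

(** * Real numbers inside the scalar field *)

Definition real_scalar (R : realType) (k : scalar_kind) :
    R -> scalar_field R k :=
  match k with
  | RealScalars => fun a : R => a
  | ComplexScalars => real_complex R
  end.

Section Scalars.
Variables (R : realType) (k : scalar_kind).
Local Notation K := (scalar_field R k).
Local Notation rscalar := (@real_scalar R k).
Implicit Types (a b : R) (t : K).

Lemma re_rscalar a : re (rscalar a) = a.
Proof. by case: k. Qed.

Lemma rscalarD a b : rscalar (a + b) = rscalar a + rscalar b.
Proof. by case: k => //=; rewrite rmorphD. Qed.

Lemma rscalarM a b : rscalar (a * b) = rscalar a * rscalar b.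
Proof. by case: k => //=; rewrite rmorphM. Qed.

Lemma rscalarN a : rscalar (- a) = - rscalar a.
Proof. by case: k => //=; rewrite rmorphN. Qed.

Lemma rscalar0 : rscalar 0 = 0.
Proof. by case: k => //=; rewrite rmorph0. Qed.

Lemma rscalar1 : rscalar 1 = 1.
Proof. by case: k => //=; rewrite rmorph1. Qed.

Lemma rscalar_norm a : `|rscalar a| = rscalar `|a|.
Proof. by case: k => //=; rewrite normc_def /= expr0n addr0 sqrtr_sqr. Qed.

Lemma ler_rscalar a b : (rscalar a <= rscalar b) = (a <= b).
Proof. by case: k => //=; rewrite lecR. Qed.

Lemma ltr_rscalar a b : (rscalar a < rscalar b) = (a < b).
Proof. by case: k => //=; rewrite ltcR. Qed.

Lemma rscalar_re t : 0 <= t -> rscalar (re t) = t.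
Proof. by case: k t => //= t t0; rewrite RRe_real// ger0_real. Qed.

Lemma reD t1 t2 : re (t1 + t2) = re t1 + re t2.
Proof. by case: k t1 t2 => //= -[a1 b1] [a2 b2]. Qed.

Lemma re_rscalarM a t : re (rscalar a * t) = a * re t.
Proof. by case: k t => //= -[b c]; rewrite /= mul0r subr0. Qed.

Lemma norm_re t : `|re t| <= re `|t|.
Proof.
case: k t => //= t; have := normc_ge_Re t.
by rewrite normc_def lecR; case: t.
Qed.

Lemma re_ge0 t : 0 <= t -> 0 <= re t.
Proof. by move=> t0; rewrite -ler_rscalar rscalar_re// rscalar0. Qed.

End Scalars.

(** * The real-valued norm and nested sets *)

Section Norm.
Variables (R : realType) (k : scalar_kind).
Local Notation K := (scalar_field R k).
Local Notation rscalar := (@real_scalar R k).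
Variable X : completeNormedModType K.
Implicit Types (x y z v w : X) (a b : R) (A : set X).

Lemma rscalar_rnorm x : rscalar (rnorm x) = `|x|.
Proof. exact: rscalar_re. Qed.

Lemma rnorm_ge0 x : 0 <= rnorm x.
Proof. exact: re_ge0. Qed.

Lemma rnormD x y : rnorm (x + y) <= rnorm x + rnorm y.
Proof. by rewrite -(ler_rscalar k) rscalarD !rscalar_rnorm ler_normD. Qed.

Lemma rnormN x : rnorm (- x) = rnorm x.
Proof. by rewrite /rnorm normrN. Qed.

Lemma rdistC x y : rnorm (x - y) = rnorm (y - x).
Proof. by rewrite -rnormN opprB. Qed.

Lemma rnormZK (t : K) x : rnorm (t *: x) = re `|t| * rnorm x.
Proof.
by rewrite /rnorm normrZ -(rscalar_re (normr_ge0 t)) re_rscalarM re_rscalar.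
Qed.

Lemma rnormZ a x : rnorm (rscalar a *: x) = `|a| * rnorm x.
Proof. by rewrite rnormZK rscalar_norm re_rscalar. Qed.

Lemma rnorm0 : rnorm (0 : X) = 0.
Proof. by rewrite /rnorm normr0 -(rscalar0 R k) re_rscalar. Qed.

Lemma rnorm0_eq0 x : rnorm x = 0 -> x = 0.
Proof.
by move=> x0; apply/eqP; rewrite -normr_eq0 -rscalar_rnorm x0 rscalar0.
Qed.

Lemma rnorm_triangle y x z : rnorm (x - z) <= rnorm (x - y) + rnorm (y - z).
Proof. by rewrite (le_trans _ (rnormD _ _))// addrA subrK. Qed.

Lemma rnorm_lerB x y : rnorm x - rnorm y <= rnorm (x - y).
Proof. by rewrite lerBlDr -{1}(subrK y x) rnormD. Qed.

Lemma unit_ballE x : unit_ball x <-> rnorm x <= 1.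
Proof. by rewrite /unit_ball /= -rscalar_rnorm -(rscalar1 R k) ler_rscalar. Qed.

(** Used with [n] equal to 1 and 2, to move the equations of the theorem from [K] to [R]. *)
Lemma norm_eq_rnorm x (n : nat) : `|x| = n%:R <-> rnorm x = n%:R.
Proof.
have <- : rscalar n%:R = n%:R by elim: n => [|n];
  rewrite ?rscalar0// !mulrS rscalarD rscalar1 => ->.
split=> [|<-]; last by rewrite rscalar_rnorm.
by rewrite /rnorm => ->; rewrite re_rscalar.
Qed.

Lemma nbhs_rnormP x A :
  nbhs x A <-> exists2 e, 0 < e & forall y, rnorm (x - y) < e -> A y.
Proof.
rewrite -nbhs_ballE; split=> [[e /= e0 eA]|[e e0 eA]].
  exists (re e) => [|y xy]; first
    by rewrite -(ltr_rscalar k) rscalar0 rscalar_re ?ltW.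
  by apply: eA; rewrite -ball_normE /ball_ /= -rscalar_rnorm -(rscalar_re (ltW
    e0)) ltr_rscalar.
exists (rscalar e) => [|y] /=; first by rewrite -(rscalar0 R k) ltr_rscalar.
by rewrite -ball_normE /ball_ /= -rscalar_rnorm ltr_rscalar; exact: eA.
Qed.

Lemma closure_rnormP A x :
  closure A x <-> forall e, 0 < e -> exists2 y, A y & rnorm (x - y) < e.
Proof.
split=> [Ax e e0|Ax B /nbhs_rnormP[e e0 eB]].
  have /Ax[y [Ay xy]] : nbhs x [set y | rnorm (x - y) < e]
    by apply/nbhs_rnormP; exists e.
  by exists y.
by have [y Ay xy] := Ax e e0; exists y; split=> //; exact: eB.
Qed.

Lemma rnorm_complete (y : nat -> X) :
  (forall e, 0 < e -> exists n, forall m, (n <= m)%N ->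
    rnorm (y n - y m) <= e) ->
  exists p, forall e, 0 < e -> exists n, forall m, (n <= m)%N ->
    rnorm (p - y m) < e.
Proof.
move=> cy.
have : cvg (y @ \oo).
  apply/cauchy_cvgP/cauchy_exP => e e0.
  have re0 : 0 < re e by rewrite -(ltr_rscalar k) rscalar0 rscalar_re ?ltW.
  have [n nP] := cy (re e / 2) ltac:(lra).
  exists (y n); exists n => // m /= nm.
  rewrite -ball_normE /ball_ /= -rscalar_rnorm -(rscalar_re (ltW e0))
    ltr_rscalar.
  by have := nP m nm; lra.
move=> /cvg_ex[p yp]; exists p => e e0.
have : nbhs p [set z | rnorm (p - z) < e] by apply/nbhs_rnormP; exists e.
by move=> /yp[n _ nP]; exists n.
Qed.

Definition rdiam_le A e := forall y z, A y -> A z -> rnorm (y - z) <= e.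

(* Cantor's intersection theorem: the nested sets are chosen inside [F]. *)
Lemma nested_point (F : set (set X)) :
  (forall A, F A -> A !=set0) ->
  (forall A e, F A -> 0 < e ->
     exists B, [/\ F B, closure B `<=` A & rdiam_le B e]) ->
  forall A, F A -> exists2 p, A p &
    forall e, 0 < e -> exists B, [/\ F B, B p & rdiam_le B e].
Proof.
move=> F0 Fshrink A FA.
(* The index carried along with a set prescribes the diameter of the next one. *)
have /choice[next nextP] : forall s : {B | F B} * nat, exists T : {B | F B},
    closure (sval T) `<=` sval s.1 /\ rdiam_le (sval T) (s.2.+1%:R^-1).
  move=> [[S FS] n]; have [|T [FT TS dT]] := Fshrink S (n.+1%:R^-1) FS.
    by rewrite invr_gt0 ltr0Sn.
  by exists (exist _ T FT).
pose fix T n : {B | F B} := if n is m.+1 then next (T m, m) else exist _ A FA.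
have Tsub n m : (n <= m)%N -> sval (T m) `<=` sval (T n).
  move=> /subnK <-; elim: (m - n)%N => [//|j IH]; apply: subset_trans IH.
  by move=> z /subset_closure/(proj1 (nextP (T (j + n)%N, (j + n)%N))).
have /choice[y yT] : forall n, exists y, sval (T n) y by move=> n;
  case: (T n) => B; exact: F0.
have Tdiam n : rdiam_le (sval (T n.+1)) (n.+1%:R^-1)
  by exact: (proj2 (nextP (_, _))).
have arch e : 0 < e -> exists n, n.+1%:R^-1 <= e :> R.
  move=> e0; exists (Num.truncn (e^-1)).
  rewrite -[leRHS]invrK lef_pV2 ?posrE ?invr_gt0 ?ltr0Sn//.
  by rewrite ltW// truncnS_gt.
have [|p pP] := @rnorm_complete y.
  move=> e /arch[n ne]; exists n.+1 => m nm.
  by rewrite (le_trans _ ne)//; apply: Tdiam => //; exact: Tsub _ _ nm _ (yT m).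
(* [p] is a limit of points of [T n.+1], whose closure lies in [T n]. *)
have pT n : sval (T n) p.
  apply: (proj1 (nextP (T n, n))); apply/closure_rnormP => e /pP[m mP].
  exists (y (maxn m n.+1)); first by apply: (Tsub n.+1 _ _ _ (yT _));
    exact: leq_maxr.
  by apply: mP; exact: leq_maxl.
exists p; first exact: (pT 0%N).
move=> e /arch[n ne]; exists (sval (T n.+1)); split => //; first exact: svalP.
by move=> u v Tu Tv; exact: le_trans (Tdiam n _ _ Tu Tv) ne.
Qed.

End Norm.

(** * The Hahn-Banach theorem for real-linear functionals *)

Section HahnBanach.
Variables (R : realType) (k : scalar_kind).
Local Notation K := (scalar_field R k).
Local Notation rscalar := (@real_scalar R k).
Variable X : lmodType K.
Implicit Types (x y z v w : X) (a b : R).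

Definition real_linear (u : X -> R) :=
  forall a v w, u (rscalar a *: v + w) = a * u v + u w.

Section RealLinear.
Variable u : X -> R.
Hypothesis ul : real_linear u.

Lemma real_linearD v w : u (v + w) = u v + u w.
Proof. by have := ul 1 v w; rewrite rscalar1 scale1r mul1r. Qed.

Lemma real_linear0 : u 0 = 0.
Proof. by have := real_linearD 0 0; rewrite addr0; lra. Qed.

Lemma real_linearZ a v : u (rscalar a *: v) = a * u v.
Proof. by have := ul a v 0; rewrite !addr0 real_linear0 addr0. Qed.

Lemma real_linearN v : u (- v) = - u v.
Proof. by rewrite -scaleN1r -(rscalar1 R k) -rscalarN real_linearZ mulN1r. Qed.

Lemma real_linearB v w : u (v - w) = u v - u w.
Proof. by rewrite real_linearD real_linearN. Qed.

End RealLinear.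

(** Positive homogeneity is asked as an inequality only, which is easy to check for infima; equality
    follows by rescaling with the inverse. *)
Definition sublinear (p : X -> R) :=
  (forall v w, p (v + w) <= p v + p w) /\
  (forall a v, 0 <= a -> p (rscalar a *: v) <= a * p v).

Lemma sublinearZ p a v : sublinear p -> 0 <= a -> p (rscalar a *: v) = a * p v.
Proof.
move=> [pD pZ] a0; apply/eqP; rewrite eq_le pZ//=.
have [->|an0] := eqVneq a 0.
  by rewrite mul0r rscalar0 scale0r; have := pD 0 0; rewrite addr0; lra.
have agt0 : 0 < a by rewrite lt_neqAle eq_sym an0.
rewrite -ler_pdivlMl// (le_trans _ (pZ _ _ _)) ?invr_ge0//.
by rewrite scalerA -rscalarM mulVf// rscalar1 scale1r.
Qed.

Lemma sublinear0 p : sublinear p -> p 0 = 0.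
Proof.
by move=> /sublinearZ/(_ (lexx 0)) h;
  rewrite -(scale0r 0) -(rscalar0 R k) h mul0r.
Qed.

Lemma sublinearN p v : sublinear p -> - p (- v) <= p v.
Proof.
by move=> ps; have := ps.1 v (- v); rewrite subrr (sublinear0 ps); lra.
Qed.

(* Every pointwise infimum below is over a set bounded from below, so that
   [inf] is not its junk value. *)
Lemma sublinear_inf (T : Type) (D : set T) (f : T -> X -> R) (l : X -> R) :
  D !=set0 -> (forall t v, D t -> l v <= f t v) ->
  (forall s t v w, D s -> D t -> exists2 r,
    D r & f r (v + w) <= f s v + f t w) ->
  (forall a t v, 0 <= a -> D t -> exists2 r,
    D r & f r (rscalar a *: v) <= a * f t v) ->
  sublinear (fun v => inf [set f t v | t in D]).
Proof.
move=> [t0 Dt0] lf fD fZ.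
have f_inf t v : D t -> inf [set f t v | t in D] <= f t v.
  move=> Dt; apply: ge_inf; last by exists t.
  by exists (l v) => _ [s Ds <-]; exact: lf.
have inf_f v b : (forall t, D t -> b <= f t v) -> b <= inf [set f t v | t in D].
  move=> bf; apply: lb_le_inf; first by exists (f t0 v), t0.
  by move=> _ [t Dt <-]; exact: bf.
split=> [v w|a v a0].
  rewrite -lerBlDr; apply: (inf_f) => s Ds; rewrite lerBlDr -lerBlDl.
  apply: (inf_f) => t Dt; rewrite lerBlDl.
  by have [r Dr rD] := fD s t v w Ds Dt; apply: le_trans rD; exact: f_inf.
have [a00|an0] := eqVneq a 0.
  rewrite {2}a00 mul0r; have [r Dr] := fZ a t0 v a0 Dt0.
  by rewrite {2}a00 mul0r; apply: le_trans; exact: (f_inf).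
have agt0 : 0 < a by rewrite lt_neqAle eq_sym an0.
rewrite -ler_pdivrMl//; apply: (inf_f) => t Dt; rewrite ler_pdivrMl//.
by have [r Dr rZ] := fZ a t v a0 Dt; apply: le_trans rZ; exact: f_inf.
Qed.

(* A minimal sublinear functional is linear. *)
Theorem hahn_banach (p : X -> R) : sublinear p ->
  exists2 u, real_linear u & forall v, u v <= p v.
Proof.
move=> ps.
pose T := {q : X -> R | sublinear q /\ forall v, q v <= p v}.
pose mkT q qs qp : T := exist _ q (conj qs qp).
(* Reversed order: the maximal element given by Zorn's lemma is a minimal functional. *)
pose below (s t : T) := `[< forall v, sval t v <= sval s v >].
have [//|||A Atot|[q [qs qp]] qmin] := @Zorn T below.
- by move=> s; apply/asboolP.
- move=> r s t /asboolP rs /asboolP st; apply/asboolP => v.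
  exact: le_trans (st v) (rs v).
- move=> [s Ps] [t Pt] /asboolP /= st /asboolP /= ts; apply: eq_exist.
  by apply/funext => v; apply/eqP; rewrite eq_le st ts.
- have [A0|/set0P/negP/negPn/eqP A0] := pselect (A !=set0); last first.
    by exists (mkT p ps (fun v => lexx _)) => s; rewrite A0.
  have lbA (t : T) v : A t -> - p (- v) <= sval t v.
    case: t => t [ts tp] /= _; apply: le_trans (sublinearN v ts).
    by rewrite lerN2.
  have infs : sublinear (fun v => inf [set sval t v | t in A]).
    apply: (sublinear_inf A0 lbA) => [s t v w As At|a t v a0 At]; last first.
      by exists t => //; case: t {At} => t [ts tp] /=; exact: ts.2.
    have [/asboolP st|/asboolP ts] := Atot _ _ As At.
      exists t => //; rewrite (le_trans ((svalP t).1.1 _ _))// lerD2r;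
        exact: st.
    exists s => //; rewrite (le_trans ((svalP s).1.1 _ _))// lerD2l; exact: ts.
  have inf_le t v : A t -> inf [set sval t v | t in A] <= sval t v.
    move=> At; apply: ge_inf; last by exists t.
    by exists (- p (- v)) => _ [s As <-]; exact: lbA.
  have infp v : inf [set sval t v | t in A] <= p v.
    have [t At] := A0; apply: le_trans (inf_le _ _ At) _.
    exact: (svalP t).2.
  by exists (mkT _ infs infp) => s As; apply/asboolP => v; exact: inf_le.
have qD v w : q (v + w) = q v + q w.
  apply/eqP; rewrite eq_le qs.1 /=.
  (* [qw] is sublinear and below [q], hence equal to [q] by minimality; its competitor [t = 1] then
     gives [q v + q w <= q (v + w)]. *)
  pose qw x := inf [set q (x + rscalar t *: w) - t * q w | t in [set t :
    R | 0 <= t]].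
  have lbq (t : R) x : 0 <= t -> - q (- x) <= q (x + rscalar t *: w) - t * q w.
    move=> t0; rewrite -(sublinearZ w qs t0).
    have := qs.1 (- x) (x + rscalar t *: w); rewrite addKr; lra.
  have qws : sublinear qw.
    apply: (@sublinear_inf _ _ _ (fun x => - q (- x))).
    - by exists 0 => /=.
    - by move=> t x /=; exact: lbq.
    - move=> s t x y /= s0 t0; exists (s + t); first exact: addr_ge0.
      rewrite rscalarD scalerDl addrACA mulrDl.
      by have := qs.1 (x + rscalar s *: w) (y + rscalar t *: w); lra.
    - move=> a t x a0 t0; exists (a * t); first exact: mulr_ge0.
      rewrite rscalarM -scalerA -scalerDr (sublinearZ _ qs a0).
      by rewrite mulrBr mulrA.
  have qwq (t : R) x : 0 <= t -> qw x <= q (x + rscalar t *: w) - t * q w.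
    move=> t0; apply: ge_inf; last by exists t.
    by exists (- q (- x)) => _ [s s0 <-]; exact: lbq.
  have qw_le_q x : qw x <= q x.
    by have := qwq 0 x (lexx 0); rewrite rscalar0 scale0r addr0 mul0r subr0.
  have /(congr1 sval) /= qwE := qmin (mkT qw qws (fun x => le_trans (qw_le_q x)
    (qp x)))
    (introT (asboolP _) qw_le_q).
  have := qwq 1 v ler01; rewrite qwE rscalar1 scale1r mul1r; lra.
exists q => // a v w; rewrite qD; congr (_ + _).
have [a0|a0] := leP 0 a; first exact: sublinearZ.
have := qD (rscalar a *: v) (rscalar (- a) *: v).
rewrite -scalerDl -rscalarD subrr rscalar0 scale0r (sublinear0 qs).
rewrite (sublinearZ v qs (ltac:(by rewrite oppr_ge0 ltW) : 0 <= - a)); lra.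
Qed.

End HahnBanach.

(** * Functionals as real parts, and supports of the ball *)

Section ImaginaryUnit.
Variables (R : realType) (k : scalar_kind).
Local Notation K := (scalar_field R k).
Local Notation rscalar := (@real_scalar R k).

(* For real scalars, the value [0] makes the formulas below degenerate
   correctly. *)
Definition im_unit : K :=
  match k with RealScalars => 0 | ComplexScalars => 'i%C end.

Lemma im_unit_sqr : im_unit = 0 \/ im_unit * im_unit = -1.
Proof. by rewrite /im_unit; case: k; [left|right; rewrite -expr2 sqr_i]. Qed.

Lemma re_im_unitM a : re (im_unit * rscalar a) = 0.
Proof. by rewrite /im_unit; case: k => /=; rewrite ?mul0r// mulr0 subrr. Qed.

(** As [re (i t)] is minus the imaginary part, this is the usual decomposition; it recovers a linear
    functional from its real part. *)
Lemma scalar_decomp (t : K) :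
  t = rscalar (re t) - im_unit * rscalar (re (im_unit * t)).
Proof.
rewrite /im_unit; case: k t => /= [t|[a b]]; first by rewrite !mul0r subr0.
by apply/eqP; rewrite eq_complex /=; apply/andP; split; apply/eqP; ring.
Qed.

Lemma norm_im_unit : `|im_unit| <= 1.
Proof.
rewrite /im_unit; case: k => /=; first by rewrite normr0 ler01.
by rewrite normc_def /= expr0n expr1n add0r sqrtr1.
Qed.

End ImaginaryUnit.
Arguments im_unit {R k}.

Section Functionals.
Variables (R : realType) (k : scalar_kind).
Local Notation K := (scalar_field R k).
Local Notation rscalar := (@real_scalar R k).
Variable X : completeNormedModType K.
Implicit Types (x y z v w : X) (a b : R) (u : X -> R).

(** These are exactly the real parts of the elements of [dual X], by [real_functional_re] and
    [real_functional_dual]. *)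
Definition real_functional u :=
  real_linear u /\ exists M, forall v, `|u v| <= M * rnorm v.

Lemma real_functional_le u : real_functional u ->
  exists2 M, 0 < M & forall v, `|u v| <= M * rnorm v.
Proof.
move=> [_ [M uM]]; exists (Num.max M 1); first by rewrite lt_max ltr01 orbT.
move=> v; apply: le_trans (uM v) _.
by rewrite ler_wpM2r ?rnorm_ge0// le_max lexx.
Qed.

Lemma real_functional_comb u g a : real_functional u -> real_functional g ->
  real_functional (fun v => u v + a * g v).
Proof.
move=> [ul [M uM]] [gl [N gN]]; split=> [b v w|]; first by rewrite ul gl; ring.
exists (M + `|a| * N) => v; rewrite mulrDl -mulrA (le_trans (ler_normD _ _))//.
by rewrite lerD// normrM ler_wpM2l.
Qed.

Lemma real_functional_re (f : {linear X -> K^o}) :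
  dual X f -> real_functional (fun v => re (f v)).
Proof.
move=> fc; split=> [a v w|].
  by rewrite linearP reD -re_rscalarM.
have /linear_boundedP : bounded_near f (nbhs (0 : X)).
  exact/linear_bounded_continuous.
move=> /pinfty_ex_gt0[M M0 fM]; exists (re M) => v.
rewrite (le_trans (norm_re _))// -(ler_rscalar k) rscalarM rscalar_rnorm.
by rewrite !rscalar_re// ltW.
Qed.

(** The usual complexification [f v = u v - i u (i v)], bounded by twice the bound of [u]; with real
    scalars it is [u] itself. *)
Lemma real_functional_dual u : real_functional u ->
  exists2 f : {linear X -> K^o}, dual X f & forall v, re (f v) = u v.
Proof.
move=> uf; have [ul _] := uf; have [M M0 uM] := real_functional_le uf.
pose f (v : X) : K^o := rscalar (u v) - im_unit * rscalar (u (im_unit *: v)).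
have uZ (t : K) v :
    u (t *: v) = re t * u v - re (im_unit * t) * u (im_unit *: v).
  rewrite {1}(scalar_decomp t) scalerBl -scalerA real_linearB// real_linearZ//.
  by congr (_ - _); rewrite scalerA mulrC -scalerA real_linearZ.
have flin : linear f.
  move=> t v w; rewrite /f scalerDr !(real_linearD ul) !rscalarD scalerA (uZ t
    v) (uZ (im_unit * t) v).
  rewrite !(rscalarM, rscalarD, rscalarN).
  transitivity ((rscalar (re t) - im_unit * rscalar (re (im_unit * t))) *
      (rscalar (u v) - im_unit * rscalar (u (im_unit *: v))) +
      (rscalar (u w) - im_unit * rscalar (u (im_unit *: w)))); last first.
    by rewrite -scalar_decomp.
  have [i0|i2] := im_unit_sqr R k;
    first by rewrite i0 !mul0r !subr0 -{1}(rscalar0 R k) re_rscalar rscalar0;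
    ring.
  have -> : re (im_unit * (im_unit * t)) = - re t.
    by rewrite mulrA i2 mulN1r -[in LHS](mulN1r t) -(rscalar1 R k) -rscalarN
      re_rscalarM mulN1r.
  by rewrite rscalarN; ring: i2.
pose F : {linear X -> K^o} := HB.pack f (GRing.isLinear.Build K X K^o *:%R f
  flin).
exists F => [|v]; last first.
  rewrite /F /= /f reD re_rscalar -mulrN -rscalarN re_im_unitM addr0//.
apply/linear_bounded_continuous/linear_boundedP.
near=> r => v; apply: (@le_trans _ _ (rscalar (2 * M) * `|v|)); last first.
  rewrite ler_wpM2r//; near: r; apply: nbhs_pinfty_ge.
  by rewrite ger0_real// -(rscalar0 R k) ler_rscalar; lra.
have uiv : `|u (im_unit *: v)| <= M * rnorm v.
  apply: le_trans (uM _) _; rewrite ler_wpM2l ?(ltW M0)// rnormZK ler_piMl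
    ?rnorm_ge0//.
  by rewrite -(ler_rscalar k) rscalar_re// rscalar1 norm_im_unit.
apply: le_trans (ler_normB _ _) _;
  rewrite normrM !rscalar_norm -rscalar_rnorm -rscalarM.
apply: (@le_trans _ _ (rscalar `|u v| + rscalar `|u (im_unit *: v)|)).
  by rewrite lerD2l ler_piMl ?norm_im_unit// -(rscalar0 R k) ler_rscalar.
by rewrite -rscalarD ler_rscalar; have := uM v; lra.
Unshelve. all: by end_near. Qed.

(* The functional [p] below is the infimal convolution of the norm and of [-u]
   restricted to the cone. *)
Lemma cone_sandwich (Z : set X) u (d : R) :
  real_linear u -> 0 <= d -> Z 0 ->
  (forall y z, Z y -> Z z -> Z (y + z)) ->
  (forall a z, 0 <= a -> Z z -> Z (rscalar a *: z)) ->
  (forall z, Z z -> u z <= d * rnorm z) ->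
  exists e, [/\ real_linear e, forall v, `|e v| <= d * rnorm v &
                forall z, Z z -> u z <= e z].
Proof.
move=> ul d0 Z0 ZD ZZ ud.
pose p v := inf [set d * rnorm (v + z) - u z | z in Z].
have lbp z v : Z z -> - (d * rnorm v) <= d * rnorm (v + z) - u z.
  move=> Zz; have := ud z Zz; have := ler_wpM2l d0 (rnormD (v + z) (- v)).
  by rewrite [v + z]addrC addrK rnormN mulrDr; lra.
have ps : sublinear p.
  apply: (@sublinear_inf _ _ _ _ _ _ (fun v => - (d * rnorm v))) lbp _ _.
  - by exists 0.
  - move=> y z v w Zy Zz; exists (y + z); first exact: ZD.
    rewrite addrACA (real_linearD ul).
    by have := ler_wpM2l d0 (rnormD (v + y) (w + z)); lra.
  - move=> a z v a0 Zz; exists (rscalar a *: z); first exact: ZZ.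
    by rewrite -scalerDr rnormZ (real_linearZ ul) ger0_norm// mulrBr mulrCA.
have p_le z v : Z z -> p v <= d * rnorm (v + z) - u z.
  move=> Zz; apply: ge_inf; last by exists z.
  by exists (- (d * rnorm v)) => _ [y Zy <-]; exact: lbp.
(* [e] lies below [p]: the competitor [z = 0] bounds [e] by [d] times the norm, and at [- z] the
   competitor [z] gives [u z <= e z]. *)
have [e el ep] := hahn_banach ps.
have ele v : e v <= d * rnorm v.
  apply: le_trans (ep v) _; apply: le_trans (p_le 0 v Z0) _.
  by rewrite addr0 (real_linear0 ul) subr0.
exists e; split=> // [v|z Zz].
  by rewrite ler_norml ele andbT; have := ele (- v);
    rewrite (real_linearN el) rnormN; lra.
have := le_trans (ep (- z)) (p_le z (- z) Zz).
by rewrite addNr rnorm0 mulr0 sub0r (real_linearN el) lerN2.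
Qed.

Lemma unit_ball_conv x y a : 0 <= a <= 1 -> unit_ball x -> unit_ball y ->
  unit_ball (rscalar (1 - a) *: x + rscalar a *: y).
Proof.
move=> /andP[a0 a1] /unit_ballE x1 /unit_ballE y1; apply/unit_ballE.
apply: le_trans (rnormD _ _) _; rewrite !rnormZ !ger0_norm ?subr_ge0//.
have := ler_wpM2l a0 y1; have := @ler_wpM2l _ (1 - a) _ _ _ x1.
by rewrite subr_ge0 a1 => /(_ isT); lra.
Qed.

(* Hahn-Banach, applied to the cone of directions that enter the ball at [y]. *)
Lemma approximate_support u (d : R) y : real_linear u -> 0 <= d ->
  unit_ball y ->
  (forall z, unit_ball z -> u z - u y <= d * rnorm (z - y)) ->
  exists e, [/\ real_linear e, forall v, `|e v| <= d * rnorm v &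
                forall z, unit_ball z -> u z - u y <= e z - e y].
Proof.
move=> ul d0 By ud.
pose Z := [set z | exists2 t, 0 < t & unit_ball (y + rscalar t *: z)].
have [|v w [s s0 Bs] [t t0 Bt]|a z a0 [t t0 Bt]|z [t t0 Bt]|e [el ed ue]] :=
    @cone_sandwich Z u d ul d0.
- by exists 1 => //; rewrite scaler0 addr0.
- have st0 : 0 < s + t by rewrite addr_gt0.
  (* The new point is the convex combination of [y + s v] and [y + t w] with weights [t / (s + t)]
     and [s / (s + t)]. *)
  exists (s * t / (s + t)); first by rewrite divr_gt0// mulr_gt0.
  have sst : 0 <= s / (s + t) <= 1.
    by rewrite (divr_ge0 (ltW s0) (ltW st0)) ler_pdivrMr// mul1r lerDl ltW.
  have := unit_ball_conv sst Bs Bt.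
  congr unit_ball; rewrite !scalerDr addrACA -scalerDl -rscalarD subrK rscalar1
    scale1r.
  by rewrite !scalerA -!rscalarM; congr (_ + (rscalar _ *: _ + rscalar _ *:
    _)); field; lra.
- have [->|an0] := eqVneq a 0.
    by exists 1 => //; rewrite rscalar0 scale0r scaler0 addr0.
  have agt0 : 0 < a by rewrite lt_neqAle eq_sym an0.
  exists (t / a); first by rewrite divr_gt0.
  by rewrite scalerA -rscalarM divfK.
- have := ud _ Bt; rewrite (real_linearD ul) [u y + _]addrC addrK (real_linearZ
    ul) [y + _]addrC addrK.
  by rewrite rnormZ gtr0_norm// mulrCA ler_pM2l.
exists e; split=> // z Bz; rewrite -(real_linearB ul) -(real_linearB el);
  apply: ue.
by exists 1 => //; rewrite rscalar1 scale1r addrC subrK.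
Qed.

End Functionals.

(** * Slices of the unit ball and Ekeland's principle *)

Section Slices.
Variables (R : realType) (k : scalar_kind).
Local Notation K := (scalar_field R k).
Local Notation rscalar := (@real_scalar R k).
Variable X : completeNormedModType K.
Implicit Types (x y z v w : X) (a b c : R) (u h : X -> R) (A S : set X).

(** The estimate holds for both orders of [v] and [w]: [phi] is Lipschitz, so its sublevel sets are
    closed. *)
Lemma closure_lipschitz (phi : X -> R) (M c : R) A :
  (forall v w, phi v - phi w <= M * rnorm (v - w)) ->
  (forall v, A v -> phi v <= c) -> forall v, closure A v -> phi v <= c.
Proof.
move=> phiM Ac v /closure_rnormP Av; apply/ler_addgt0Pr => e e0.
have M0 : 0 < `|M| + 1 by have := normr_ge0 M; lra.
have [w Aw vw] := Av (e / (`|M| + 1)) (divr_gt0 e0 M0).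
have := Ac w Aw; have := phiM v w; rewrite ltr_pdivlMr// in vw.
have := ler_wpM2r (rnorm_ge0 (v - w)) (ler_norm M); have := rnorm_ge0 (v - w);
  lra.
Qed.

Lemma unit_ball0 : unit_ball (0 : X).
Proof. by apply/unit_ballE; rewrite rnorm0 ler01. Qed.

Lemma unit_ball_closure A : A `<=` unit_ball -> closure A `<=` unit_ball.
Proof.
move=> AB v Av; apply/unit_ballE;
  apply: (@closure_lipschitz (@rnorm R k X) 1 1 A _ _ v Av) => [y z|y
  /AB/unit_ballE//].
by rewrite mul1r rnorm_lerB.
Qed.

Lemma real_functional_lipschitz u : real_functional u ->
  exists2 M, 0 < M & forall v w, u v - u w <= M * rnorm (v - w).
Proof.
move=> uf; have [M M0 uM] := real_functional_le uf; exists M => // v w.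
by rewrite -(real_linearB uf.1); exact: le_trans (ler_norm _) (uM _).
Qed.

Lemma ball_has_sup u : real_functional u -> has_sup [set u z | z in unit_ball].
Proof.
move=> uf; have [M M0 uM] := real_functional_le uf.
split; first by exists (u 0), 0 => //; exact: unit_ball0.
exists M => _ [z /unit_ballE z1 <-]; apply: le_trans (ler_norm _) _.
by apply: le_trans (uM z) _; rewrite ler_piMr// ltW.
Qed.

(** [T w] collects the points that raise [u] by at least [eta] times their distance to [w]. These
    sets are closed and nested, and become small when [u] is almost maximal at [w]; a common point
    [p] of small ones has [T p] reduced to [p]. *)
Lemma ekeland_unit_ball u eta z : real_functional u -> 0 < eta -> unit_ball z ->
  exists p, [/\ unit_ball p, eta * rnorm (p - z) <= u p - u z &
    forall w, unit_ball w -> u w - u p <= eta * rnorm (w - p)].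
Proof.
move=> uf eta0 Bz.
pose T w := [set v | unit_ball v /\ eta * rnorm (v - w) <= u v - u w].
have TT v w : T w v -> T v `<=` T w.
  move=> [_ vw] y [By yv]; split=>//.
  by have := ler_wpM2l (ltW eta0) (rnorm_triangle v y w); lra.
have Trefl w : unit_ball w -> T w w by move=> Bw; split=> //;
  rewrite !subrr rnorm0 mulr0.
have [M M0 uM] := real_functional_lipschitz uf.
have Tclosed w : closure (T w) `<=` T w.
  move=> v Tv; split; first by apply: unit_ball_closure Tv => y [].
  suff : eta * rnorm (v - w) - u v <= - u w by lra.
  apply: (@closure_lipschitz (fun v => eta * rnorm (v - w) - u v) (eta + M) (-
    u w) (T w) _ _ v Tv) => [y y'|y [_]]; last lra.
  have := ler_wpM2l (ltW eta0) (rnorm_triangle y' y w).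
  by have := uM y' y; rewrite (rdistC y' y); lra.
have [||p [Bp zp] psmall] := @nested_point R k X [set T w | w in unit_ball] _ _
  (T z) (ex_intro2 _ _ z Bz erefl).
- by move=> _ [w Bw <-]; exists w; exact: Trefl.
- move=> _ e [w Bw <-] e0.
  have supT : has_sup [set u v | v in T w].
    split; first by exists (u w), w => //; exact: Trefl.
    have [_ [m mP]] := ball_has_sup uf; exists m => _ [v [Bv _] <-].
    by apply: mP; exists v.
  (* A point [w'] within [eta * e / 2] of the supremum leaves no room in [T w'] for points farther
     than [e / 2] from [w']. *)
  have ee : 0 < eta * e / 2 by rewrite divr_gt0// mulr_gt0.
  have [_ [w' Tw' <-] w'sup] := sup_adherent ee supT.
  exists (T w'); split; first by exists w' => //; case: Tw'.
    by apply: subset_trans (TT _ _ Tw'); exact: Tclosed.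
  have near v : T w' v -> rnorm (v - w') <= e / 2.
    move=> Tv; have vsup : u v <= sup [set u v | v in T w].
      by apply: (ub_le_sup supT.2); exists v => //; exact: TT Tw' _ Tv.
    rewrite -(ler_pM2l eta0); case: Tv => _; lra.
  move=> y y' /near h1 /near h2.
  by have := rnorm_triangle w' y y'; rewrite (rdistC w' y'); lra.
exists p; split=> // w Bw; rewrite leNgt; apply/negP => pw.
have Tpw : T p w by split=> //; exact: ltW.
have : rnorm (w - p) <= 0.
  apply/ler_addgt0Pr => e e0; rewrite add0r.
  have [_ [[w' _ <-] Tp dT]] := psmall e e0; apply: dT =>//.
  exact: TT Tp _ Tpw.
move=> wp0; have wp : rnorm (w - p) = 0 by apply/eqP;
  rewrite eq_le wp0 rnorm_ge0.
by move: pw; rewrite wp mulr0 (subr0_eq (rnorm0_eq0 wp)) subrr ltxx.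
Qed.

Definition ball_slice u c : set X := [set y | unit_ball y /\ c < u y].

Lemma slice_unit_ballP S : slice unit_ball S -> exists u c,
  [/\ real_functional u, exists v, u v != 0,
    ball_slice u c !=set0 & S = ball_slice u c].
Proof.
move=> [f [alpha [fd fn0 alpha0 ->]]].
have uf := real_functional_re fd.
exists (fun v => re (f v)), (sup [set re (f z) | z in unit_ball] - alpha);
  split=>//.
  apply: contrapT => /forallNP u0; apply: fn0; apply/funext => v.
  have u0' w : re (f w) = 0 by apply/eqP; apply: contrapT => /negP; exact: u0.
  have iv : im_unit * f v = f (im_unit *: v) by rewrite linearZ.
  by rewrite (scalar_decomp (f v)) iv !u0' rscalar0 mulr0 subrr.
have [_ [y By <-] ysup] := sup_adherent alpha0 (ball_has_sup uf).
by exists y; split.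
Qed.

Lemma ball_slice_slice u c v : real_functional u -> u v != 0 ->
  ball_slice u c !=set0 -> slice unit_ball (ball_slice u c).
Proof.
move=> uf uv [y [By cy]]; have [f fd fu] := real_functional_dual uf.
have fE : (fun v => re (f v)) = u by apply/funext.
have supE : sup [set re (f z) | z in unit_ball] = sup [set u z | z in
  unit_ball].
  by rewrite fE.
exists f, (sup [set u z | z in unit_ball] - c); split=>//.
- move=> f0; move/eqP: uv; apply; rewrite -fu f0 -(rscalar0 R k) re_rscalar//.
- rewrite subr_gt0 (lt_le_trans cy)//; apply: (ub_le_sup (ball_has_sup uf).2).
  by exists y.
- by apply/seteqP; split=> z /=; rewrite supE fu subKr.
Qed.

End Slices.

(** * Denting points *)

Section Denting.
Variables (R : realType) (k : scalar_kind).
Local Notation K := (scalar_field R k).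
Local Notation rscalar := (@real_scalar R k).
Variable X : completeNormedModType K.
Implicit Types (x y z v w : X) (a b c : R) (u h : X -> R) (A S D : set X).

Lemma real_convex_set A :
  (forall x y a, 0 <= a <= 1 -> A x -> A y ->
     A (rscalar (1 - a) *: x + rscalar a *: y)) -> @convex_set K X A.
Proof.
move=> cA x y l /set_mem Ax /set_mem Ay; apply/mem_set.
have l0 : 0 <= l%:num by [].
have l1 : l%:num <= 1 by [].
have := cA y x (re l%:num) _ Ay Ax;
  rewrite rscalarD rscalarN rscalar_re// rscalar1.
rewrite addrC; apply.
by rewrite -!(ler_rscalar k) rscalar_re// rscalar0 rscalar1 l0.
Qed.

Definition closed_convex_hull A : set X :=
  [set x | forall D, closed D -> @convex_set K X D -> A `<=` D -> D x].

Lemma sub_closed_convex_hull A : A `<=` closed_convex_hull A.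
Proof. by move=> x Ax D _ _; apply. Qed.

Lemma closed_convex_hull_min A D :
  closed D -> @convex_set K X D -> A `<=` D -> closed_convex_hull A `<=` D.
Proof. by move=> cD vD AD x; apply. Qed.

Lemma closed_closed_convex_hull A : closed (closed_convex_hull A).
Proof.
move=> x Ax D cD vD AD; apply: (cD); apply: closureS Ax.
exact: closed_convex_hull_min.
Qed.

Lemma convex_closed_convex_hull A : @convex_set K X (closed_convex_hull A).
Proof.
move=> x y l /set_mem Ax /set_mem Ay; apply/mem_set => D cD vD AD.
have Dx : x \in D by apply/mem_set; exact: Ax.
have Dy : y \in D by apply/mem_set; exact: Ay.
exact/set_mem/(vD x y l Dx Dy).
Qed.

Lemma closed_unit_ball : closed (unit_ball : set X).
Proof. by apply: unit_ball_closure. Qed.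

Lemma convex_unit_ball : @convex_set K X unit_ball.
Proof. by apply: real_convex_set => x y a a01 Bx By; exact: unit_ball_conv. Qed.

Lemma sub_unit_ball_bounded A : A `<=` unit_ball -> bounded_set A.
Proof.
move=> AB; exists 1; split; first exact: real1.
by move=> M M1 x Ax; exact: le_trans (AB x Ax) (ltW M1).
Qed.

Lemma halfspace_closed_convex u c : real_functional u ->
  closed [set x | u x <= c] /\ @convex_set K X [set x | u x <= c].
Proof.
move=> uf; split.
  have [M _ uM] := real_functional_lipschitz uf.
  by move=> x; exact: closure_lipschitz uM _ _.
apply: real_convex_set => x y a /andP[a0 a1] /= xc yc.
rewrite uf.1 (real_linearZ uf.1).
have a1' : 0 <= 1 - a by rewrite subr_ge0.
have := ler_wpM2l a0 yc; have := ler_wpM2l a1' xc; lra.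
Qed.

Lemma diam_lt_rdiam_le A e : (diam A < e%:E)%E -> rdiam_le A e.
Proof.
move=> Ae y z Ay Az; rewrite -lee_fin (le_trans _ (ltW Ae))//.
by apply: ereal_sup_ubound; exists y => //; exists z.
Qed.

Lemma rdiam_le_diam A e : rdiam_le A e -> (diam A <= e%:E)%E.
Proof.
by move=> Ae; apply: ge_ereal_sup => _ [y Ay [z Az <-]]; rewrite lee_fin Ae.
Qed.

(* [A] consists of the points of the ball supported by functionals close to
   [u] (approximate_support). If [g] cuts off a small slice of the hull of [A]
   that contains a point [y0] of [A], supported by [u - l], monotonicity of
   supports shows that the points of [A] supported close to [u - l + lam g] lie
   in this small slice, for [lam] small; by Ekeland, every point of a thin slice
   given by [u - l + lam g] is close to such a point. *)
Lemma ball_slice_shrink u c v0 e : Radon_Nikodym_property X ->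
  real_functional u -> u v0 != 0 -> ball_slice u c !=set0 -> 0 < e ->
  exists h d, [/\ real_functional h, exists v, h v != 0, ball_slice h d !=set0,
     closure (ball_slice h d) `<=` ball_slice u c & rdiam_le (ball_slice h d)
       e].
Proof.
move=> RN uf uv0 [y1 [By1 cy1]] e0.
have v0n := rnorm_ge0 v0.
(* [de] bounds the perturbation of [u]: small against [u y1 - c], it keeps the new slice in the old
   one; small against [u v0], it keeps the new functional nonzero at [v0]. *)
have [de [de0 de_c de_v]] : exists de,
    [/\ 0 < de, de <= (u y1 - c) / 8 & de * rnorm v0 < `|u v0|].
  have q0 : 0 < `|u v0| / (rnorm v0 + 1) by rewrite divr_gt0 ?normr_gt0//; lra.
  exists (Num.min ((u y1 - c) / 8) (`|u v0| / (rnorm v0 + 1))); split.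
  - by rewrite lt_min q0 andbT; lra.
  - by rewrite ge_min lexx.
  - apply: (@le_lt_trans _ _ (`|u v0| / (rnorm v0 + 1) * rnorm v0)).
      by rewrite ler_wpM2r// ge_min lexx orbT.
    rewrite -mulrA gtr_pMr ?normr_gt0// mulrC ltr_pdivrMr//; lra.
pose A : set X := [set y | unit_ball y /\ exists d : R, [/\ 0 <= d, d < de &
   forall z, unit_ball z -> u z - u y <= d * rnorm (z - y)]].
have AB : A `<=` unit_ball by move=> y [].
have A0 : A !=set0.
  (* Ekeland's principle, started at 0, produces a point of [A]. *)
  have de2 : 0 < de / 2 by lra.
  have [p [Bp _ pP]] := ekeland_unit_ball uf de2 (@unit_ball0 R k X).
  by exists p; split=> //; exists (de / 2); split => //; lra.
pose E := closed_convex_hull A.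
have EB : E `<=` unit_ball.
  exact: closed_convex_hull_min closed_unit_ball convex_unit_ball AB.
have [|p [Ep pdent]] := RN E _ (@closed_closed_convex_hull A)
    (@convex_closed_convex_hull A) (sub_unit_ball_bounded EB).
  by have [y Ay] := A0; exists y; exact: sub_closed_convex_hull.
have [|_ [[f [alpha [fd _ alpha0 ->]]] [_ ps] Sdiam]] := pdent (e / 2).
  by rewrite divr_gt0.
move: ps Sdiam; set s := sup _ - alpha; pose g v := re (f v).
rewrite -/(g p) => ps /diam_lt_rdiam_le Sdiam.
have gf : real_functional g := real_functional_re fd.
(* Otherwise the half-space [g <= s] would contain [A], hence its closed convex hull, hence [p]. *)
have [y0 [Ay0 sy0]] : exists y0, A y0 /\ s < g y0.
  apply: contrapT => /forallNP ns; move: ps; rewrite ltNge => /negP; apply.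
  have [cH vH] := halfspace_closed_convex s gf.
  apply: (closed_convex_hull_min cH vH _ Ep) => y Ay /=.
  by rewrite leNgt; apply/negP => sy; apply: (ns y).
have [By0 [d0 [d00 d0de d0P]]] := Ay0.
have [l [ll ld lP]] := approximate_support uf.1 d00 By0 d0P.
have lf : real_functional l by split=> //; exists d0.
have [G G0 gG] := real_functional_le gf.
(* [lam] uses half of the margin [de - d0]: the bound on [h - u] is [d0 + (de - d0) / 2]. *)
pose lam := (de - d0) / (2 * G).
have lam0 : 0 < lam by rewrite divr_gt0 ?mulr_gt0// subr_gt0.
have lamG : lam * G = (de - d0) / 2 by rewrite /lam; field; lra.
pose h v := u v + -1 * l v + lam * g v.
have hf : real_functional h.
  exact: (real_functional_comb lam (real_functional_comb (-1) uf lf) gf).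
have hu v : `|h v - u v| <= (de + d0) / 2 * rnorm v.
  have -> : h v - u v = - l v + lam * g v by rewrite /h; ring.
  rewrite (le_trans (ler_normD _ _))// normrN normrM (gtr0_norm lam0).
  have := ler_wpM2l (ltW lam0) (gG v); rewrite mulrA lamG.
  by have := ld v; lra.
have hu_de v : `|h v - u v| <= de * rnorm v.
  by apply: le_trans (hu v) _; rewrite ler_wpM2r ?rnorm_ge0//; lra.
(* The first bound makes the support constant [(de + d0) / 2 + eta] at most
   [(3 * de + d0) / 4 < de]; the second keeps [g] above [s], distances in the ball being at most
   2. *)
pose eta := Num.min ((de - d0) / 4) (lam * (g y0 - s) / 4).
have gs0 : 0 < lam * (g y0 - s) by rewrite mulr_gt0// subr_gt0.
have eta0 : 0 < eta by rewrite lt_min; apply/andP; split; lra.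
have eta_de : eta <= (de - d0) / 4 by rewrite ge_min lexx.
have eta_g : eta <= lam * (g y0 - s) / 4 by rewrite ge_min lexx orbT.
have supported z : unit_ball z ->
    (forall w, unit_ball w -> h w - h z <= eta * rnorm (w - z)) ->
    A z /\ s < g z.
  move=> Bz zP; split.
    split=> //; exists ((3 * de + d0) / 4); split; [lra|lra|move=> w Bw].
    have := zP w Bw; have := hu (w - z).
    rewrite (real_linearB hf.1) (real_linearB uf.1) ler_norml => /andP[h1 _].
    have := ler_wpM2r (rnorm_ge0 (w - z)) eta_de; lra.
  have yz2 : rnorm (y0 - z) <= 2.
    move: By0 Bz => /unit_ballE y01 /unit_ballE z1.
    by rewrite (le_trans (rnormD _ _))// rnormN; lra.
  (* [u - l] is maximal at [y0], so [lam * (g y0 - g z)] is at most [h y0 - h z], hence at most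
     [2 * eta]. *)
  have := zP y0 By0; have := lP z Bz; rewrite /h.
  have := ler_wpM2l (ltW eta0) yz2; rewrite -(ltr_pM2l lam0); lra.
(* Depth of the new slice: the first bound keeps it in the old one, the second puts each of its
   points within [e / 4] of a point given by Ekeland's principle. *)
pose a := Num.min ((u y1 - c) / 8) (eta * e / 8).
have a0 : 0 < a by rewrite lt_min divr_gt0 ?subr_gt0//= divr_gt0 ?mulr_gt0.
have a_c : a <= (u y1 - c) / 8 by rewrite ge_min lexx.
have a_e : a <= eta * e / 8 by rewrite ge_min lexx orbT.
have hsup := ball_has_sup hf.
have sup_ge z : unit_ball z -> h z <= sup [set h z | z in unit_ball].
  by move=> Bz; apply: (ub_le_sup hsup.2); exists z.
exists h, (sup [set h z | z in unit_ball] - a); split=>//.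
- exists v0; apply/eqP => h0; have := hu_de v0.
  by rewrite h0 sub0r normrN; lra.
- by have [_ [z Bz <-] az] := sup_adherent a0 hsup; exists z.
- move=> z Sz; have Bz : unit_ball z.
    by apply: unit_ball_closure Sz => w [].
  split=> //; have : - h z <= - (sup [set h z | z in unit_ball] - a).
    have [M _ hM] := real_functional_lipschitz hf.
    apply: (@closure_lipschitz _ _ _ (fun v => - h v) M _ _ _ _ z Sz) => [v w|v
      [_]].
      by rewrite rdistC; have := hM w v; lra.
    by rewrite lerN2 => /ltW.
  (* [u] and [h] differ by at most [de] on the ball, so [u z] is at least [u y1 - a - 2 * de], which
     exceeds [c]. *)
  move: (hu_de z) (hu_de y1) (sup_ge _ By1).
  have dz w : unit_ball w -> de * rnorm w <= de.
    by move=> /unit_ballE w1; rewrite ler_piMr// ltW.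
  rewrite !ler_norml => /andP[_ h1] /andP[h2 _].
  by have := dz _ Bz; have := dz _ By1; lra.
- have near z : ball_slice h (sup [set h z | z in unit_ball] - a) z ->
      exists2 z', E z' /\ s < g z' & rnorm (z' - z) <= e / 4.
    move=> [Bz az]; have [z' [Bz' zz' z'P]] := ekeland_unit_ball hf eta0 Bz.
    have [Az' sz'] := supported z' Bz' z'P.
    exists z'; first by split=> //; exact: sub_closed_convex_hull.
    by rewrite -(ler_pM2l eta0); have := sup_ge z' Bz'; lra.
  move=> y z /near[y' [Ey' sy'] yy'] /near[z' [Ez' sz'] zz'].
  have := Sdiam y' z' (conj Ey' sy') (conj Ez' sz').
  have := rnorm_triangle y' y z; have := rnorm_triangle z' y' z.
  by rewrite (rdistC y y'); lra.
Qed.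

(** Nested slices of vanishing diameter shrink to a denting point. *)
Lemma slice_denting S : Radon_Nikodym_property X -> slice unit_ball S ->
  exists2 y, S y & denting_points unit_ball y.
Proof.
move=> RN /slice_unit_ballP FS; pose F : set (set X) :=
  [set S | exists u c, [/\ real_functional u,
   exists v, u v != 0, ball_slice u c !=set0 & S = ball_slice u c]].
have [||p Sp pP] := @nested_point R k X F _ _ S FS.
- by move=> _ [u [c [_ _ u0 ->]]].
- move=> _ e [u [c [uf [v uv] u0 ->]]] e0.
  have [h [d [hf h0 hd0 hsub hdiam]]] := ball_slice_shrink RN uf uv u0 e0.
  by exists (ball_slice h d); split=> //; exists h, d.
exists p => //; split.
  by have [_ [[u [c [_ _ _ ->]]] [? _] _]] := pP 1 ltr01.
move=> e e0; have [|_ [[u [c [uf [v uv] u0 ->]]] Tp Td]] := pP (e / 2).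
  by rewrite divr_gt0.
exists (ball_slice u c); split=> //; first exact: ball_slice_slice uf uv u0.
by apply: le_lt_trans (rdiam_le_diam Td) _; rewrite lte_fin; lra.
Qed.

End Denting.

(** * Points of continuity *)

Section WeakTopology.
Variables (R : realType) (k : scalar_kind).
Local Notation K := (scalar_field R k).
Local Notation rscalar := (@real_scalar R k).
Variable X : completeNormedModType K.
Implicit Types (p x y z v w : X) (a b c d e : R) (A W : set X) (l :
  seq (dual X)).

(** These sums define the basic weak neighbourhoods; a sum, unlike a maximum, turns concatenation of
    lists into addition. *)
Definition weak_seminorm l v : R := \sum_(f <- l) re `|set_val f v|.

Lemma weak_seminorm_cat l1 l2 v :
  weak_seminorm (l1 ++ l2) v = weak_seminorm l1 v + weak_seminorm l2 v.
Proof. exact: big_cat. Qed.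

Lemma weak_seminorm_ge0 l v : 0 <= weak_seminorm l v.
Proof. by apply: sumr_ge0 => f _; exact: re_ge0. Qed.

Lemma weak_seminormD l v w :
  weak_seminorm l (v + w) <= weak_seminorm l v + weak_seminorm l w.
Proof.
rewrite -big_split; apply: ler_sum => f _ /=.
by rewrite -(ler_rscalar k) rscalarD !rscalar_re// linearD ler_normD.
Qed.

Lemma weak_seminormZ l a v : weak_seminorm l (rscalar a *: v) = `|a| *
  weak_seminorm l v.
Proof.
rewrite /weak_seminorm mulr_sumr; apply: eq_bigr => f _.
by rewrite linearZ normrM rscalar_norm re_rscalarM.
Qed.

Lemma weak_seminorm_lipschitz l :
  exists M, forall v w, weak_seminorm l v - weak_seminorm l w <= M * rnorm (v -
    w).
Proof.
suff [M lM] : exists M, forall v, weak_seminorm l v <= M * rnorm v.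
  exists M => v w; have := weak_seminormD l (v - w) w; rewrite subrK.
  by have := lM (v - w); lra.
elim: l => [|f l [M lM]].
  by exists 0 => v; rewrite /weak_seminorm big_nil mul0r.
have /linear_boundedP : bounded_near (set_val f) (nbhs (0 : X)).
  by apply/linear_bounded_continuous; exact: set_valP f.
move=> /pinfty_ex_gt0[N N0 fN]; exists (re N + M) => v.
rewrite /weak_seminorm big_cons mulrDl; apply: lerD; last exact: lM.
by rewrite -(ler_rscalar k) rscalarM rscalar_rnorm (rscalar_re (normr_ge0 _))
  (rscalar_re (ltW N0)).
Qed.

(** The weak topology comes from the evaluation [ev] into a product, so both directions are checked
    one functional at a time. *)
Lemma nbhs_weakP z A : nbhs (z : weak X) A <->
  exists l e, 0 < e /\ forall w, weak_seminorm l (w - z) < e -> A w.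
Proof.
pose ev : X -> prod_topology (fun _ : dual X => (K^o : topologicalType)) :=
  fun x (f : dual X) => set_val f x.
split=> [|[l [e [e0 leA]]]]; last first.
  apply: (filterS leA); clear leA; elim: l e e0 => [|f l IH] e e0.
    by apply: filterE => w; rewrite /weak_seminorm big_nil.
  have e20 : 0 < e / 2 by rewrite divr_gt0.
  apply: (@filterS _ _ _ ([set w | weak_seminorm l (w - z) < e / 2] `&`
      [set w | re `|set_val f (w - z)| < e / 2])).
    by move=> w [/= lw fw]; rewrite /weak_seminorm big_cons -/(weak_seminorm _
      _); lra.
  apply: filterI; first exact: IH.
  have [evz] : Filter (nbhs (ev z)) /\ nbhs (ev z) --> (ev z) by split=> //;
    exact: nbhs_filter.
  move=> /cvg_sup/(_ f) evf.
  have fN : nbhs (ev z) [set g | re `|g f - set_val f z| < e / 2].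
    apply: evf; exists ((fun g => g f) @^-1` (ball (set_val f z :
      K^o) (rscalar (e / 2)))^°).
      split; first by exists (ball (set_val f z : K^o) (rscalar (e / 2)))^°;
        [exact: open_interior|].
      by apply: nbhsx_ballx; rewrite -(rscalar0 R k) ltr_rscalar.
    move=> g /interior_subset; rewrite -ball_normE /ball_ /= distrC.
    by rewrite /= -[in X in _ -> X](ltr_rscalar k) rscalar_re.
  move: fN; rewrite nbhsE => -[V [Vo Vz] VP]; exists (ev @^-1` V);
    first by split=> //; exists V.
  by move=> w /VP /=; rewrite linearB.
pose G : set_system X := [set A |
  exists l e, 0 < e /\ forall w, weak_seminorm l (w - z) < e -> A w].
have GF : Filter G.
  split.
  - by exists [::], 1; split.
  - move=> P Q [l1 [e1 [e10 P1]]] [l2 [e2 [e20 Q2]]].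
    exists (l1 ++ l2), (Num.min e1 e2); split; first by rewrite lt_min e10.
    move=> w; rewrite weak_seminorm_cat lt_min => /andP[lw1 lw2].
    have := weak_seminorm_ge0 l1 (w - z); have := weak_seminorm_ge0 l2 (w - z).
    by split; [apply: P1; lra|apply: Q2; lra].
  - by move=> P Q PQ [l [e [e0 lP]]]; exists l, e; split=> // w /lP/PQ.
move=> [B [[U Uo <-] Uz] BA].
suff : G ((fun x (f : dual X) => set_val f x) @^-1` U) by apply: filterS.
(* It remains to show that [ev] converges along the filter [G], coordinate by coordinate. *)
suff : ev @ G --> ev z by apply; exact: open_nbhs_nbhs.
apply/cvg_sup => f V [C [[D Do <-] Dz] CV].
suff : G (ev @^-1` ((fun g => g f) @^-1` D)) by apply: filterS => w; exact: CV.
have /nbhs_ballP[e /= e0 eD] : nbhs (set_val f z : K^o) D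
  by exact: open_nbhs_nbhs.
exists [:: f], (re e); split.
  by rewrite -(ltr_rscalar k) rscalar0 rscalar_re// ltW.
move=> w; rewrite /weak_seminorm big_seq1 -(ltr_rscalar k) (rscalar_re
  (normr_ge0 _)) (rscalar_re (ltW e0)) => we.
by apply: eD; rewrite -ball_normE /ball_ /= -linearB -normrN -linearN opprB.
Qed.

Lemma relatively_weakly_openP A W : relatively_weakly_open A W <->
  W `<=` A /\ forall z, W z -> exists l e, 0 < e /\
    forall w, A w -> weak_seminorm l (w - z) < e -> W w.
Proof.
split=> [[U Uo ->]|[WA Wo]].
  split=> [w []//|z [_ Uz]].
  have /nbhs_weakP[l [e [e0 lU]]] : nbhs (z : weak X) U
    by exact: open_nbhs_nbhs.
  by exists l, e; split=> // w Aw /lU.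
(* The largest weakly open set whose trace on [A] lies in [W]. *)
pose U : set (weak X) := ((fun w => A w -> W w) : set (weak X))^°.
exists U; first exact: open_interior.
apply/seteqP; split=> [w Ww|w [Aw /interior_subset]]; last exact.
split; first exact: WA.
have [l [e [e0 lW]]] := Wo w Ww; apply/nbhs_weakP; exists l, e;
  split=> // v vw Av.
exact: lW.
Qed.

Lemma points_of_continuityP A z : points_of_continuity A z <->
  A z /\ forall e, 0 < e -> exists l d, 0 < d /\
    forall w, A w -> weak_seminorm l (w - z) < d -> rnorm (z - w) < e.
Proof.
split=> -[Az zc]; split=>//.
  move=> e e0; have : nbhs z [set w | rnorm (z - w) < e] by apply/nbhs_rnormP;
    exists e.
  move=> /zc /nbhs_weakP[l [d [d0 ld]]]; exists l, d; split=> // w Aw lw.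
  exact: ld.
move=> V /nbhs_rnormP[e e0 eV]; have [l [d [d0 ld]]] := zc e e0.
apply/nbhs_weakP; exists l, d; split=> // w lw Aw; apply: eV; exact: ld.
Qed.

(* A point of continuity of a smaller weakly closed piece of the ball is pushed
   inside this piece, along the segment towards the center of the piece. *)
Lemma weakly_open_shrink W e : convex_point_of_continuity_property X ->
  relatively_weakly_open unit_ball W -> W !=set0 -> 0 < e ->
  exists V, [/\ relatively_weakly_open unit_ball V, V !=set0,
     closure V `<=` W & rdiam_le V e].
Proof.
move=> CP /relatively_weakly_openP[WB Wo] [y0 Wy0] e0.
have [l [d [d0 lW]]] := Wo y0 Wy0.
(* The non-strict inequality makes [C] closed, while the radius [d / 2 < d] keeps it in [W]. *)
pose C : set X := [set y | unit_ball y /\ weak_seminorm l (y - y0) <= d / 2].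
have [M lM] := weak_seminorm_lipschitz l.
have lM0 v w : weak_seminorm l (v - y0) - weak_seminorm l (w - y0) <= M * rnorm
  (v - w).
  by have := lM (v - y0) (w - y0); rewrite opprD opprK addrACA addNr addr0.
have l0 l' : weak_seminorm l' 0 = 0.
  by rewrite -(scaler0 X (rscalar 0)) weak_seminormZ normr0 mul0r.
have clC : closed C.
  move=> y Cy; split; first by apply: unit_ball_closure Cy => v [].
  by apply: (closure_lipschitz lM0 _ Cy) => v [].
have cvC : @convex_set K X C.
  apply: real_convex_set => x y a /[dup] a01 /andP[a0 a1] [Bx lx] [By ly].
  split; first exact: unit_ball_conv.
  have -> : rscalar (1 - a) *: x + rscalar a *: y - y0 =
      rscalar (1 - a) *: (x - y0) + rscalar a *: (y - y0).
    rewrite !scalerBr addrACA -opprD -scalerDl -rscalarD subrK rscalar1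
      scale1r//.
  apply: le_trans (weak_seminormD _ _ _) _; rewrite !weak_seminormZ.
  have a1' : 0 <= 1 - a by rewrite subr_ge0.
  rewrite (ger0_norm a0) (ger0_norm a1').
  by have := ler_wpM2l a0 ly; have := ler_wpM2l a1' lx; lra.
have [||p /points_of_continuityP[[Bp lp] pc]] :=
  CP C _ clC cvC (sub_unit_ball_bounded _).
- by exists y0; split; [exact: WB|rewrite subrr l0 divr_ge0// ltW].
- by move=> y [].
have [|l1 [d1 [d10 l1P]]] := pc (e / 2); first by rewrite divr_gt0.
(* Strict inequalities make [V] weakly open; as [V] lies in [C], continuity at [p] relative to [C]
   bounds its diameter. *)
pose V : set X := [set y | [/\ unit_ball y, weak_seminorm l (y - y0) < d / 2 &
   weak_seminorm l1 (y - p) < d1]].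
have VC : V `<=` C by move=> y [By ly _]; split=> //; exact: ltW.
exists V; split.
- apply/relatively_weakly_openP; split=> [y []//|z [Bz lz l1z]].
  exists (l ++ l1), (Num.min (d / 2 - weak_seminorm l (z - y0)) (d1 -
    weak_seminorm l1 (z - p))).
  split; first by rewrite lt_min !subr_gt0 lz.
  move=> w Bw; rewrite weak_seminorm_cat lt_min => /andP[lw l1w].
  have := weak_seminorm_ge0 l (w - z); have := weak_seminorm_ge0 l1 (w - z).
  have := weak_seminormD l (w - z) (z - y0); rewrite addrA subrK.
  have := weak_seminormD l1 (w - z) (z - p); rewrite addrA subrK.
  by split=> //; lra.
(* The seminorm of [p - y0] may equal [d / 2]: moving [p] towards [y0] by the fraction [s] makes it
   smaller, and [s * m < d1] keeps the point weakly close to [p]. *)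
- pose m := weak_seminorm l1 (y0 - p);
    have m0 : 0 <= m := weak_seminorm_ge0 _ _.
  pose s := d1 / (d1 + m + 1).
  have s0 : 0 < s by rewrite divr_gt0//; lra.
  have s1 : s < 1 by rewrite ltr_pdivrMr; lra.
  have sm : s * m < d1.
    by rewrite /s mulrAC ltr_pdivrMr ?ltr_pM2l//; lra.
  exists (rscalar (1 - s) *: p + rscalar s *: y0); split.
  + by apply: unit_ball_conv => //; [rewrite !ltW|exact: WB].
  + have -> : rscalar (1 - s) *: p + rscalar s *: y0 - y0 = rscalar (1 - s) *:
      (p - y0).
      rewrite scalerBr -addrA; congr (_ + _).
      by rewrite rscalarD rscalarN rscalar1 scalerBl scale1r opprB.
    rewrite weak_seminormZ ger0_norm; last lra.
    apply: (@le_lt_trans _ _ ((1 - s) * (d / 2))); first by rewrite ler_wpM2l;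
      lra.
    by rewrite gtr_pMl; lra.
  + have -> : rscalar (1 - s) *: p + rscalar s *: y0 - p = rscalar s *: (y0 -
      p).
      rewrite rscalarD rscalarN rscalar1 scalerBl scale1r scalerBr addrAC [p -
        _]addrC addrK.
      by rewrite addrC.
    by rewrite weak_seminormZ gtr0_norm.
- move=> y Vy; have [By ly] : C y by apply: clC; exact: closureS Vy.
  by apply: lW => //; lra.
- move=> y z Vy Vz; have := rnorm_triangle p y z; rewrite (rdistC y p).
  have := l1P y (VC _ Vy); have := l1P z (VC _ Vz).
  by case: Vy Vz => [_ _ l1y] [_ _ l1z] /(_ l1z) + /(_ l1y); lra.
Qed.

(** A point common to weakly open sets of vanishing diameter is a point of continuity. *)
Lemma weakly_open_point_of_continuity W :
  convex_point_of_continuity_property X ->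
  relatively_weakly_open unit_ball W -> W !=set0 ->
  exists2 z, W z & points_of_continuity unit_ball z.
Proof.
move=> CP Wo W0; pose F : set (set X) :=
  [set W | relatively_weakly_open unit_ball W /\ W !=set0].
have [||p Wp pP] := @nested_point R k X F _ _ W (conj Wo W0).
- by move=> V [].
- move=> V e [Vo V0] e0; have [U [Uo U0 UV Ud]] :=
    weakly_open_shrink CP Vo V0 e0.
  by exists U.
exists p => //; apply/points_of_continuityP; split.
  by move: Wo => /relatively_weakly_openP[WB _]; exact: WB.
move=> e e0; have [|V [[/relatively_weakly_openP[_ Vo] _] Vp Vd]] := pP (e / 2).
  by rewrite divr_gt0.
have [l [d [d0 lV]]] := Vo p Vp; exists l, d; split=> // w Bw lw.
by have := Vd p w Vp (lV w Bw lw); lra.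
Qed.

(* Such a point [p] makes the weak topology as fine as the norm topology. *)
Lemma interior_point_of_continuity p : points_of_continuity unit_ball p ->
  rnorm p < 1 -> forall z, unit_ball z -> points_of_continuity unit_ball z.
Proof.
move=> /points_of_continuityP[Bp pc] p1 z Bz; pose r := 1 - rnorm p.
have r0 : 0 < r by rewrite subr_gt0.
have [|l [d [d0 lP]]] := pc r; first by [].
have small v : weak_seminorm l v < d -> rnorm v < r.
  (* Otherwise [v] could be shrunk to norm exactly [r]: its translate by [p] would stay in the ball,
     weakly close to [p] but at distance [r]. *)
  move=> lv; rewrite ltNge; apply/negP => rv.
  have v0 : 0 < rnorm v by exact: lt_le_trans rv.
  have s0 : 0 <= r / rnorm v by rewrite divr_ge0// ltW.
  have s1 : r / rnorm v <= 1 by rewrite ler_pdivrMr// mul1r.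
  have nsv : rnorm (rscalar (r / rnorm v) *: v) = r.
    by rewrite rnormZ ger0_norm// divfK// gt_eqF.
  have Bw : unit_ball (rscalar (r / rnorm v) *: v + p).
    by apply/unit_ballE; rewrite (le_trans (rnormD _ _))// nsv /r; lra.
  have := lP _ Bw; rewrite rdistC addrK weak_seminormZ ger0_norm// nsv ltxx =>
    h.
  suff : false by []; apply: h; apply: le_lt_trans lv;
    by rewrite ler_piMl// weak_seminorm_ge0.
apply/points_of_continuityP; split=> // e e0.
(* By homogeneity, [small] rescaled by [e / r] controls distances up to [e]. *)
exists l, (d * e / r); split; first by rewrite divr_gt0// mulr_gt0.
move=> w Bw lw; have re0 : 0 < r / e by rewrite divr_gt0.
have re_d : r / e * (d * e / r) = d by field; apply/andP; split; lra.
have re_r : r / e * e = r by rewrite divfK// gt_eqF.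
have := small (rscalar (r / e) *: (w - z)).
rewrite weak_seminormZ rnormZ gtr0_norm// rdistC => h.
rewrite -(ltr_pM2l re0) re_r; apply: h.
by rewrite -[ltRHS]re_d ltr_pM2l.
Qed.

End WeakTopology.

(** * Rotations *)

Section Rotations.
Variables (R : realType) (k : scalar_kind).
Local Notation K := (scalar_field R k).

Lemma normc_le_ReDIm (x y : R) : Normc.normc (complex.Complex x y) <= `|x| +
  `|y|.
Proof.
rewrite /= -[leRHS]ger0_norm ?addr_ge0// -sqrtr_sqr ler_wsqrtr//.
rewrite sqrrD !real_normK ?num_real// lerD2r lerDl mulrn_wge0// mulr_ge0//.
Qed.

(** For complex scalars, the circle is the union of two arcs, each parametrized by the real part in
    [[-1, 1]], and the extreme value theorem applies to each. *)
Lemma unit_scalars_argmax (phi : K -> R) (M : R) : 0 <= M ->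
  (forall s t, phi s - phi t <= M * re `|s - t|) ->
  exists2 s, unit_scalars s & forall t, unit_scalars t -> phi t <= phi s.
Proof.
rewrite /unit_scalars; case: k phi => /= phi M0 phiM.
  have [le1|/ltW le1] := leP (phi (-1)) (phi 1); [exists 1|exists (-1)];
    rewrite /= ?normrN ?normr1// => t; have [t0|t0] := leP 0 t.
  - by rewrite ger0_norm// => ->.
  - by rewrite ltr0_norm// => /(canRL (@opprK _)) ->.
  - by rewrite ger0_norm// => ->.
  - by rewrite ltr0_norm// => /(canRL (@opprK _)) ->.
(* [c] is the sign of the imaginary part. Square roots of negative numbers are 0, so [g c] is
   continuous on the whole line. *)
pose g (c a : R) := phi (complex.Complex a (c * Num.sqrt (1 - a ^+ 2))).
have gc c : continuous (g c).
  move=> a; apply/cvgrPdist_lt => e e0.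
  have sc : {for a, continuous ((fun b : R => c * Num.sqrt (1 - b ^+ 2)) : R ->
    R)}.
    apply: cvgM; first exact: cvg_cst.
    apply: (@continuous_comp _ _ _ (fun b : R => 1 - b ^+ 2) Num.sqrt);
      last exact: sqrt_continuous.
    by apply: cvgB; [exact: cvg_cst|exact: exprn_continuous].
  (* Two coordinates this close change [phi] by at most [M * (e / (M + 1)) < e]; [M] itself may be
     0. *)
  have d0 : 0 < e / (2 * (M + 1)) by rewrite divr_gt0// mulr_gt0//; lra.
  near=> b.
  have h1 : `|a - b| < e / (2 * (M + 1)).
    by near: b; apply: (@cvgr_dist_lt _ _ _ _ _ id a) => //; exact: cvg_id.
  have h2 : `|c * Num.sqrt (1 - a ^+ 2) - c * Num.sqrt (1 - b ^+ 2)| < e / (2 *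
    (M + 1)).
    by near: b; apply: cvgr_dist_lt.
  have close x y x' y' : `|x - x'| < e / (2 * (M + 1)) ->
    `|y - y'| < e / (2 * (M + 1)) ->
      phi (complex.Complex x y) - phi (complex.Complex x' y') < e.
    move=> xx' yy'; apply: le_lt_trans (phiM _ _) _.
    have := normc_le_ReDIm (x - x') (y - y') => /(ler_wpM2l M0)/le_lt_trans;
      apply.
    apply: (@le_lt_trans _ _ (M * (e / (M + 1)))).
      rewrite ler_wpM2l//; have -> : e / (M + 1) = e / (2 * (M + 1)) + e / (2 *
        (M + 1)).
        by field; lra.
      lra.
    rewrite mulrCA gtr_pMr// ltr_pdivrMr; lra.
  by rewrite ltr_norml; apply/andP; split; [rewrite ltrNl opprB|];
    apply: close; rewrite // distrC.
have itv : (-1 : R) <= 1 by lra.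
have gmax c : exists2 a, a \in `[-1, 1] & forall b, b \in `[-1, 1] ->
  g c b <= g c a.
  by apply: EVT_max => //; apply: continuous_subspaceT => a; exact: gc.
have unit_g c a : c ^+ 2 = 1 -> a \in `[-1, 1] ->
    `|complex.Complex a (c * Num.sqrt (1 - a ^+ 2))| = 1 :> R[i].
  move=> c1; rewrite in_itv /= => /andP[a1 a2].
  rewrite normc_def /= exprMn c1 mul1r sqr_sqrtr; last by nra.
  by rewrite addrC subrK sqrtr1.
have g_unit t : `|t| = 1 :> R[i] ->
  exists c a, [/\ c = 1 \/ c = -1, a \in `[-1, 1] & phi t = g c a].
  case: t => a b; rewrite normc_def /= => -[ab].
  have {}ab : a ^+ 2 + b ^+ 2 = 1.
    by rewrite -[LHS]sqr_sqrtr ?ab ?expr1n// addr_ge0// sqr_ge0.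
  have b2 : Num.sqrt (1 - a ^+ 2) = `|b| by rewrite -sqrtr_sqr; congr Num.sqrt;
    lra.
  have aI : a \in `[-1, 1] by rewrite in_itv /=; apply/andP; split; nra.
  have [b0|/ltW b0] := leP 0 b.
    by exists 1, a; split=> //; [left|rewrite /g b2 ger0_norm// mul1r].
  by exists (-1), a; split=> //; [right|rewrite /g b2 ler0_norm// mulN1r opprK].
have [a1 a1I a1P] := gmax 1; have [a2 a2I a2P] := gmax (-1).
have [le12|/ltW le12] := leP (g (-1) a2) (g 1 a1).
  exists (complex.Complex a1 (1 * Num.sqrt (1 - a1 ^+ 2))).
    by apply: unit_g => //; rewrite expr1n.
  move=> t /g_unit[c [a [[->|->] aI ->]]]; first exact: a1P.
  exact: le_trans (a2P _ aI) le12.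
exists (complex.Complex a2 (-1 * Num.sqrt (1 - a2 ^+ 2))).
  by apply: unit_g => //; rewrite sqrrN expr1n.
move=> t /g_unit[c [a [[->|->] aI ->]]]; last exact: a2P.
exact: le_trans (a1P _ aI) le12.
Unshelve. all: by end_near. Qed.

Variable X : completeNormedModType K.
Implicit Types (x y z : X) (S : set X).

Lemma rnorm_rotation x y (t : K) : unit_scalars t ->
  rnorm (x + t *: y) <= rnorm x + rnorm y.
Proof.
move=> t1; apply: le_trans (rnormD _ _) _.
by rewrite rnormZK t1 -(rscalar1 R k) re_rscalar mul1r.
Qed.

Lemma max_rotation_attained x y :
  exists2 t, unit_scalars t & max_rotation x y = rnorm (x + t *: y).
Proof.
have [|s t|t t1 tmax] := @unit_scalars_argmax (fun t => rnorm (x + t *: y))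
  (rnorm y).
- exact: rnorm_ge0.
- apply: le_trans (rnorm_lerB _ _) _.
  by rewrite opprD addrACA subrr add0r -scalerBl rnormZK mulrC.
exists t => //; apply/eqP; rewrite eq_le; apply/andP; split.
  by apply: ge_sup; [exists (rnorm (x + t *: y)), t|move=> _ [s s1 <-];
    exact: tmax].
by apply: ub_le_sup; [exists (rnorm (x + t *: y)) => _ [s s1 <-];
  exact: tmax|exists t].
Qed.

Lemma rnorm_le_max_rotation x y (t : K) : unit_scalars t ->
  rnorm (x + t *: y) <= max_rotation x y.
Proof.
move=> t1; apply: ub_le_sup; last by exists t.
by exists (rnorm x + rnorm y) => _ [s s1 <-]; exact: rnorm_rotation.
Qed.

Lemma max_rotation_le2 x y : rnorm x = 1 -> unit_ball y ->
  max_rotation x y <= 2.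
Proof.
move=> x1 /unit_ballE y1; have [t t1 ->] := max_rotation_attained x y.
by apply: le_trans (rnorm_rotation x y t1) _; lra.
Qed.

Lemma max_rotation_lipschitz x y z :
  max_rotation x z <= max_rotation x y + rnorm (y - z).
Proof.
have [t t1 ->] := max_rotation_attained x z.
have := rnorm_le_max_rotation x y t1.
have := rnorm_lerB (x + t *: z) (x + t *: y).
rewrite opprD addrACA subrr add0r -scalerBr rnormZK t1 -(rscalar1 R k)
  re_rscalar mul1r.
by rewrite (rdistC z y); lra.
Qed.

(** One point suffices, as 2 bounds all rotations over the ball; the same bound makes [sup] a
    genuine supremum. *)
Lemma sup_max_rotation S x y (t : K) : rnorm x = 1 -> S `<=` unit_ball -> S y ->
  unit_scalars t -> `|x + t *: y| = 2 ->
    sup [set max_rotation x z | z in S] = 2.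
Proof.
move=> x1 SB Sy t1 /norm_eq_rnorm xy2; apply/eqP; rewrite eq_le; apply/andP;
  split.
  apply: ge_sup; first by exists (max_rotation x y), y.
  by move=> _ [z /SB Bz <-]; exact: max_rotation_le2.
apply: (@le_trans _ _ (max_rotation x y)).
  by rewrite -xy2; exact: rnorm_le_max_rotation.
apply: ub_le_sup; last by exists y.
by exists 2 => _ [z /SB Bz <-]; exact: max_rotation_le2.
Qed.

(** [max_rotation x] is 1-Lipschitz: if it were [2 - 2 e] at [y], it would be at most [2 - e] on a
    set of diameter [e] containing [y]. *)
Lemma rotation_attains2 x y : rnorm x = 1 -> unit_ball y ->
  (forall e, 0 < e -> exists S, [/\ S y, rdiam_le S e &
     sup [set max_rotation x z | z in S] = 2]) ->
  exists2 t, unit_scalars t & `|x + t *: y| = 2.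
Proof.
move=> x1 By small; have [t t1 ty] := max_rotation_attained x y.
exists t => //; apply/norm_eq_rnorm; rewrite -ty; apply/eqP.
rewrite eq_le max_rotation_le2//= leNgt; apply/negP => lt2.
have [|S [Sy Sd S2]] := small ((2 - max_rotation x y) / 2).
  by rewrite divr_gt0// subr_gt0.
suff : sup [set max_rotation x z | z in S] <=
    max_rotation x y + (2 - max_rotation x y) / 2 by rewrite S2; lra.
apply: ge_sup; first by exists (max_rotation x y), y.
move=> _ [z Sz <-]; apply: le_trans (max_rotation_lipschitz x y z) _.
by rewrite lerD2l; exact: Sd.
Qed.

End Rotations.

(** * Characterization of AD and super AD points *)

Theorem corollary4p11 (R : realType) (k : scalar_kind)
    (X : completeNormedModType (scalar_field R k)) (x : X)
    (hx : unit_sphere x) :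
  (Radon_Nikodym_property X ->
    (AD_point x <->
     forall y, denting_points unit_ball y ->
       exists2 theta, unit_scalars theta & `|x + theta *: y| = 2)) /\
  (convex_point_of_continuity_property X ->
    (super_AD_point x <->
     forall z, (points_of_continuity unit_ball `&` unit_sphere) z ->
       exists2 theta, unit_scalars theta & `|x + theta *: z| = 2)).
Proof.
have x1 : rnorm x = 1 by apply: (norm_eq_rnorm x 1).1.
split=> [RN|CP]; split.
- move=> [_ AD] y [By ydent]; apply: rotation_attains2 => // e e0.
  have [S [Ssl Sy Sd]] := ydent e e0.
  by exists S; split=> //; [exact: diam_lt_rdiam_le|exact: AD].
- move=> dent2; split=> // S Ssl; have [y Sy ydent] := slice_denting RN Ssl.
  have [t t1 xy2] := dent2 y ydent.
  apply: sup_max_rotation t1 xy2 =>//.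
  by have [f [alpha [_ _ _ ->]]] := Ssl; move=> z [].
- move=> [_ sAD] z [/points_of_continuityP[Bz zc] z1].
  apply: rotation_attains2 => // e e0.
  have [|l [d [d0 ld]]] := zc (e / 2); first by rewrite divr_gt0.
  (* [W] is weakly open in the ball, small by continuity at [z], and meets the sphere at [z]. *)
  pose W : set X := [set w | unit_ball w /\ weak_seminorm l (w - z) < d].
  have Wz : W z.
    by split=> //; rewrite subrr -(scaler0 X (real_scalar k 0)) weak_seminormZ
      normr0 mul0r.
  exists W; split=>//.
    move=> v w [Bv lv] [Bw lw]; have := rnorm_triangle z v w.
    by have := ld v Bv lv; have := ld w Bw lw; rewrite (rdistC v z); lra.
  apply: sAD; [|by exists z|by exists z].
  apply/relatively_weakly_openP; split=> [w []//|v [Bv lv]].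
  exists l, (d - weak_seminorm l (v - z)); split; first by rewrite subr_gt0.
  move=> w Bw lw; split=>//.
  by have := weak_seminormD l (w - v) (v - z); rewrite addrA subrK; lra.
- move=> pc2; split=> // W Wo W0 [w [Ww w1]].
  have WB : W `<=` unit_ball by have /relatively_weakly_openP[] := Wo.
  have [z Wz zc] : exists2 z, W z & (points_of_continuity unit_ball `&`
    unit_sphere) z.
    have [p Wp pc] := weakly_open_point_of_continuity CP Wo W0.
    (* Either [p] has norm 1, or it is interior and then every point of the ball, in particular [w],
       is a point of continuity. *)
    have /unit_ballE := WB p Wp; rewrite le_eqVlt => /orP[/eqP p1|p1].
      by exists p => //; split=> //; apply: (norm_eq_rnorm p 1).2.
    by exists w => //; split=> //; exact: interior_point_of_continuity pc p1 _
      (WB w Ww).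
  have [t t1 xz2] := pc2 z zc.
  exact: sup_max_rotation x1 WB Wz t1 xz2.
Qed.
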